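(* For $\operatorname{Re}(s)>1$ (and hence for the meromorphic continuations), \[ S_{1,s}^{++}\left(0,\tfrac12\right)=2^{s}\big(\eta_H(s)+\zeta_H(s)\big)-\zeta_H\left(s,\tfrac12\right) \] and \[ \zeta_O(s)=\frac12\left(2^{s}-1\right)\zeta_H(s)-2^{s-1}\eta_H(s). \]
   Context: $H_n=\sum_{j=1}^n\frac1j$ ($H_0=0$), $O_n=\sum_{j=1}^{n}\frac{1}{2j-1}$, and for $a>0$, $H_n(a)=\sum_{j=0}^{n}\frac{1}{j+a}$. For $\operatorname{Re}(s)>1$ define $\zeta_H(s)=\sum_{n=1}^{\infty}\frac{H_n}{n^s}$, $\eta_H(s)=\sum_{n=1}^{\infty}(-1)^{n-1}\frac{H_n}{n^s}$, $\zeta_H(s,\tfrac12)=\sum_{n=0}^{\infty}\frac{H_n(1/2)}{(n+1/2)^s}$, $S_{1,s}^{++}(0,\tfrac12)=\sum_{n=1}^{\infty}\frac{H_n}{(n+1/2)^s}$, and $\zeta_O(s)=\sum_{n=1}^{\infty}\frac{O_n}{n^s}$. *)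

(* Defs.v *)
(* Stdlib reals with Coquelicot's complex numbers. *)
From Stdlib Require Import Reals.
From Coquelicot Require Import Coquelicot.

Open Scope R_scope.

Definition harm (n : nat) : R := sum_n_m (fun j => / INR j) 1 n.

Definition odd_harm (n : nat) : R := sum_n_m (fun j => / (2 * INR j - 1)) 1 n.

(* The sum has n + 1 terms, j = 0, ..., n. *)
Definition harm_shift (a : R) (n : nat) : R := sum_n (fun j => / (INR j + a)) n.

Definition Cexp (z : C) : C := (exp (Re z) * cos (Im z), exp (Re z) * sin (Im z)).

(* x ^ s with the real logarithm of the base; meaningful for 0 < x. *)
Definition Rcpow (x : R) (s : C) : C := Cexp (s * ln x)%C.

(* Total operator, like [Series]: the sum when the series converges. *)
Definition CSeries (a : nat -> C) : C :=
  (Series (fun n => Re (a n)), Series (fun n => Im (a n))).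

(* The series below that start at 1 have n-th term at index S n; all of them
   converge absolutely for 1 < Re s, the only region where they are used. *)
Definition zeta_H (s : C) : C :=
  CSeries (fun n => harm (S n) / Rcpow (INR (S n)) s)%C.

Definition eta_H (s : C) : C :=
  CSeries (fun n => (-1) ^ n * harm (S n) / Rcpow (INR (S n)) s)%C.

Definition zeta_H_half (s : C) : C :=
  CSeries (fun n => harm_shift (1 / 2) n / Rcpow (INR n + 1 / 2) s)%C.

Definition S_half (s : C) : C :=
  CSeries (fun n => harm (S n) / Rcpow (INR (S n) + 1 / 2) s)%C.

Definition zeta_O (s : C) : C :=
  CSeries (fun n => odd_harm (S n) / Rcpow (INR (S n)) s)%C.

Definition analytic_at (f : C -> C) (z0 : C) : Prop :=
  exists (a : nat -> C) (r : R), 0 < r /\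
    forall z : C, Cmod (z - z0) < r ->
      is_pseries (K := C_AbsRing) (V := C_NormedModule) a (z - z0)%C (f z).

(* At a pole, and at a removable singularity, the value f z0 is arbitrary. *)
Definition meromorphic_at (f : C -> C) (z0 : C) : Prop :=
  exists k : nat, analytic_at (fun z => (z - z0) ^ k * f z)%C z0.

(* F is a meromorphic function on the whole plane extending the restriction of
   f to the half-plane 1 < Re s. *)
Definition meromorphic_continuation (f F : C -> C) : Prop :=
  (forall z : C, meromorphic_at F z) /\ (forall s : C, 1 < Re s -> F s = f s).

(* Main.v *)
(** In the half-plane of convergence both relations come from splitting the
    series of H_n / n^s into odd and even n and using
    H_(2n) = O_n + H_n / 2 and H_(2n+1) = O_(n+1) + H_n / 2, where
    H_n(1/2) = 2 O_(n+1).
    For the continuations, fix s and restrict to the horizontal line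
    t |-> s + t with t real: real and imaginary parts are then locally real power series
    divided by a power of t - t0, and they vanish for t large. If m is the supremum of the
    points to whose immediate right such a function does not vanish, the
    expansion at m vanishes on the right of m, hence identically, which contradicts the
    choice of m. *)

Require Import Defs.
From Stdlib Require Import Reals Lra Lia.
From Coquelicot Require Import Coquelicot.

Open Scope R_scope.

(** * Real meromorphic functions *)

(** If [g z] were nonzero, continuity with tolerance [Rabs (g z)] would fail at a zero slightly to
    the right of [z]. *)
Lemma continuity_pt_zero_right (g : R -> R) (z d : R) :
  continuity_pt g z -> 0 < d -> (forall y, z < y < z + d -> g y = 0) -> g z = 0.
Proof.
intros cg dp gz.
destruct (Req_dec (g z) 0) as [|nz]; [easy|exfalso].
destruct (cg (Rabs (g z))) as [al [alp H]]; [now apply Rabs_pos_lt|].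
assert (mp : 0 < Rmin al d) by now apply Rmin_pos.
pose proof (Rmin_l al d); pose proof (Rmin_r al d).
specialize (H (z + Rmin al d / 2)).
simpl in H; unfold Rdist in H.
rewrite gz in H by lra.
rewrite Rminus_0_l, Rabs_Ropp in H.
apply (Rlt_irrefl (Rabs (g z))), H.
repeat split; [lra|].
rewrite Rabs_right; lra.
Qed.

(** Beyond the radius of convergence the terms do not tend to 0, so convergence at [y] forces the
    radius to be at least [y]. *)
Lemma ex_pseries_CV_radius (a : nat -> R) (x y : R) :
  Rabs x < y -> ex_pseries a y -> Rbar_lt (Rabs x) (CV_radius a).
Proof.
intros xy ea.
apply Rbar_lt_le_trans with (Finite y); [easy|].
apply Rbar_not_lt_le; intros h.
pose proof (Rabs_pos x).
apply (CV_disk_outside a y); [now rewrite (Rabs_right y) by lra|].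
apply ex_series_lim_0.
apply ex_series_ext with (2 := ea); intros n.
unfold scal; simpl; unfold mult; simpl.
rewrite pow_n_pow; ring.
Qed.

Definition analytic_real (f : R -> R) (x0 : R) : Prop :=
  exists (a : nat -> R) (r : R), 0 < r /\
    forall x, Rabs (x - x0) < r -> is_pseries a (x - x0) (f x).

Definition meromorphic_real (f : R -> R) (x0 : R) : Prop :=
  exists k : nat, analytic_real (fun x => (x - x0) ^ k * f x) x0.

(** The midpoint of [Rabs x] and [r] still lies in the disc, and convergence there puts [x] strictly
    inside the radius. *)
Lemma analytic_real_radius (a : nat -> R) (r x0 : R) (f : R -> R) :
  (forall x, Rabs (x - x0) < r -> is_pseries a (x - x0) (f x)) ->
  forall x, Rabs x < r -> Rbar_lt (Rabs x) (CV_radius a).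
Proof.
intros H x xr.
apply ex_pseries_CV_radius with ((Rabs x + r) / 2); [lra|].
pose proof (Rabs_pos x).
replace ((Rabs x + r) / 2) with ((x0 + (Rabs x + r) / 2) - x0) by ring.
eexists; apply H.
replace (x0 + (Rabs x + r) / 2 - x0) with ((Rabs x + r) / 2) by ring.
rewrite Rabs_right; lra.
Qed.

(** * Closure of analytic and meromorphic real functions under arithmetic *)

Lemma analytic_real_ext (f g : R -> R) (x0 : R) :
  (forall x, f x = g x) -> analytic_real f x0 -> analytic_real g x0.
Proof.
intros e (a & r & rp & H); exists a, r; split; [easy|].
intros x hx; rewrite <- e; auto.
Qed.

Lemma analytic_real_plus (f g : R -> R) (x0 : R) :
  analytic_real f x0 -> analytic_real g x0 -> analytic_real (fun x => f x + g x) x0.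
Proof.
intros (a & r & rp & H) (b & q & qp & G).
exists (PS_plus a b), (Rmin r q); split; [now apply Rmin_pos|].
intros x hx; apply (is_pseries_plus (V := R_NormedModule)).
- apply H; eapply Rlt_le_trans; [apply hx|apply Rmin_l].
- apply G; eapply Rlt_le_trans; [apply hx|apply Rmin_r].
Qed.

Lemma analytic_real_mult (f g : R -> R) (x0 : R) :
  analytic_real f x0 -> analytic_real g x0 -> analytic_real (fun x => f x * g x) x0.
Proof.
intros (a & r & rp & H) (b & q & qp & G).
exists (PS_mult a b), (Rmin r q); split; [now apply Rmin_pos|].
intros x hx.
assert (hr : Rabs (x - x0) < r) by (eapply Rlt_le_trans; [apply hx|apply Rmin_l]).
assert (hq : Rabs (x - x0) < q) by (eapply Rlt_le_trans; [apply hx|apply Rmin_r]).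
apply is_pseries_mult; [now apply H|now apply G| |].
- now apply (analytic_real_radius a r x0 f).
- now apply (analytic_real_radius b q x0 g).
Qed.

Lemma is_pseries_const (c x : R) :
  is_pseries (fun n => match n with O => c | S _ => 0 end) x c.
Proof.
enough (H : is_lim_seq (sum_n (fun n => scal (pow_n (K := R_AbsRing) x n)
  (match n with O => c | S _ => 0 end))) c) by exact H.
apply (is_lim_seq_ext (fun _ => c)); [|apply is_lim_seq_const].
induction n as [|n IH].
- rewrite sum_O; change (c = 1 * c); ring.
- rewrite sum_Sn, <- IH.
  change (c = c + pow_n (K := R_AbsRing) x (S n) * 0); ring.
Qed.

Lemma analytic_real_const (c x0 : R) : analytic_real (fun _ => c) x0.
Proof.
exists (fun n => match n with O => c | S _ => 0 end), 1; split; [lra|].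
intros x _; apply is_pseries_const.
Qed.

Lemma analytic_real_sub (x0 : R) : analytic_real (fun x => x - x0) x0.
Proof.
exists (PS_incr_1 (fun n => match n with O => 1 | S _ => 0 end)), 1; split; [lra|].
intros x _.
replace (x - x0) with (scal (x - x0) 1) at 2
  by (unfold scal; simpl; unfold mult; simpl; ring).
apply (is_pseries_incr_1 (V := R_NormedModule)), is_pseries_const.
Qed.

Lemma analytic_real_pow (x0 : R) (k : nat) : analytic_real (fun x => (x - x0) ^ k) x0.
Proof.
induction k as [|k IH]; [exact (analytic_real_const 1 x0)|].
simpl; apply analytic_real_mult; [apply analytic_real_sub|easy].
Qed.

Lemma analytic_real_exp (c x0 : R) : analytic_real (fun x => exp (c * x)) x0.
Proof.
(* Factoring out [exp (c * x0)] leaves an exponential series centred at [x0]. *)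
apply analytic_real_ext with (fun x => exp (c * x0) * exp (c * (x - x0))).
  intros x; rewrite <- exp_plus; f_equal; ring.
apply analytic_real_mult; [apply analytic_real_const|].
exists (fun n => c ^ n * / INR (Factorial.fact n)), 1; split; [lra|].
intros x _.
apply (is_series_ext
  (fun n => scal (pow_n (K := R_AbsRing) (c * (x - x0)) n) (/ INR (Factorial.fact n))));
  [|apply is_exp_Reals].
intros n.
change (pow_n (K := R_AbsRing) (c * (x - x0)) n * / INR (Factorial.fact n) =
  pow_n (K := R_AbsRing) (x - x0) n * (c ^ n * / INR (Factorial.fact n))).
rewrite (pow_n_pow (c * (x - x0))), (pow_n_pow (x - x0)), Rpow_mult_distr; ring.
Qed.

Lemma meromorphic_real_ext (f g : R -> R) (x0 : R) :
  (forall x, f x = g x) -> meromorphic_real f x0 -> meromorphic_real g x0.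
Proof.
intros e [k H]; exists k.
apply analytic_real_ext with (2 := H); intros x; now rewrite e.
Qed.

Lemma meromorphic_real_plus (f g : R -> R) (x0 : R) :
  meromorphic_real f x0 -> meromorphic_real g x0 ->
  meromorphic_real (fun x => f x + g x) x0.
Proof.
intros [k H] [l G]; exists (k + l)%nat.
apply analytic_real_ext with
  (fun x => (x - x0) ^ l * ((x - x0) ^ k * f x) + (x - x0) ^ k * ((x - x0) ^ l * g x)).
  intros x; rewrite pow_add; ring.
apply analytic_real_plus; apply analytic_real_mult; auto using analytic_real_pow.
Qed.

Lemma meromorphic_real_mult (f g : R -> R) (x0 : R) :
  meromorphic_real f x0 -> meromorphic_real g x0 ->
  meromorphic_real (fun x => f x * g x) x0.
Proof.
intros [k H] [l G]; exists (k + l)%nat.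
apply analytic_real_ext with (fun x => ((x - x0) ^ k * f x) * ((x - x0) ^ l * g x)).
  intros x; rewrite pow_add; ring.
now apply analytic_real_mult.
Qed.

Lemma analytic_real_meromorphic (f : R -> R) (x0 : R) :
  analytic_real f x0 -> meromorphic_real f x0.
Proof.
intros H; exists 0%nat.
apply analytic_real_ext with (2 := H); intros x; simpl; ring.
Qed.

(** * The identity theorem for real meromorphic functions *)

Lemma pseries_zero_right (a : nat -> R) (d : R) :
  0 < d -> (forall x, 0 < x < d -> is_pseries a x 0) -> forall n, a n = 0.
Proof.
intros dp H n; revert a H; induction n as [|n IH]; intros a H;
  (assert (a0 : a 0%nat = 0); [|try exact a0]).
(* In the base case and the induction step alike, [a 0] is the value at 0 of a sum that vanishes on
   the right of 0; convergence at [d / 2] makes that sum continuous at 0. *)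
1, 2: rewrite <- (PSeries_0 a);
  apply continuity_pt_zero_right with d;
  [apply PSeries_continuity, ex_pseries_CV_radius with (d / 2);
    [rewrite Rabs_R0; lra|exists 0; apply H; lra]
  |easy|intros y hy; apply is_pseries_unique, H; lra].
(* As [a 0 = 0], dividing by [x] shows that the shifted series sums to 0 on the same interval. *)
apply (IH (PS_decr_1 a)); intros x hx.
replace 0 with (scal (/ x) (plus 0 (opp (a 0%nat)))).
2: { rewrite a0; unfold scal, plus, opp; simpl; unfold mult; simpl; ring. }
apply (is_pseries_decr_1 (V := R_NormedModule)); [|apply H; lra].
unfold mult, one; simpl; field; lra.
Qed.

(** The point [x] itself is left out because the value at a pole is arbitrary. *)
Definition zero_right (f : R -> R) (x : R) : Prop :=
  exists d, 0 < d /\ forall y, x < y < x + d -> f y = 0.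

(** Vanishing on the right kills every coefficient of the expansion of [(y - x) ^ k * f y], which
    also governs the left side; the power cancels except at [x]. *)
Lemma meromorphic_real_zero_punctured (f : R -> R) (x : R) :
  meromorphic_real f x -> zero_right f x ->
  exists r, 0 < r /\ forall y, y <> x -> Rabs (y - x) < r -> f y = 0.
Proof.
intros [k (a & r & rp & H)] (d & dp & Z).
exists r; split; [easy|]; intros y yx hy.
assert (az : forall n, a n = 0).
{ apply pseries_zero_right with (Rmin r d); [now apply Rmin_pos|].
  intros t ht; pose proof (Rmin_l r d); pose proof (Rmin_r r d).
  specialize (H (x + t)).
  replace (x + t - x) with t in H by ring.
  rewrite Z, Rmult_0_r in H by lra.
  apply H; rewrite Rabs_right; lra. }
specialize (H y hy); apply is_pseries_unique in H.
assert (e : (y - x) ^ k * f y = 0).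
{ rewrite <- H, <- (PSeries_const_0 (y - x)); apply PSeries_ext, az. }
apply Rmult_integral in e; destruct e as [e|]; [|easy].
exfalso; revert e; apply pow_nonzero; lra.
Qed.

(** At [y] the expansion centred at [x] is the limit of its values just to the right of [y], where
    [f] vanishes; the power of [y - x] then cancels. The radius [r] thus replaces intervals that
    depend on [y]. *)
Lemma meromorphic_real_zero_right (f : R -> R) (x : R) :
  meromorphic_real f x -> (forall y, x < y -> zero_right f y) -> zero_right f x.
Proof.
intros [k (a & r & rp & H)] Z.
exists r; split; [easy|]; intros y hy.
assert (e : PSeries a (y - x) = 0).
{ destruct (Z y) as (d & dp & Zd); [lra|].
  apply continuity_pt_zero_right with (Rmin d (x + r - y)).
  - apply PSeries_continuity.
    apply (analytic_real_radius _ _ _ _ H); rewrite Rabs_right; lra.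
  - apply Rmin_pos; lra.
  - intros t ht; pose proof (Rmin_l d (x + r - y)); pose proof (Rmin_r d (x + r - y)).
    apply is_pseries_unique.
    specialize (H (x + t)).
    replace (x + t - x) with t in H by ring.
    rewrite Zd, Rmult_0_r in H by lra.
    apply H; rewrite Rabs_right; lra. }
rewrite (is_pseries_unique _ _ _ (H y ltac:(rewrite Rabs_right; lra))) in e.
apply Rmult_integral in e; destruct e as [e|]; [|easy].
exfalso; revert e; apply pow_nonzero; lra.
Qed.

(** The supremum argument makes [f] vanish immediately to the right of every point; analyticity at
    [x] carries this over to [f x], which meromorphy alone leaves arbitrary. *)
Lemma meromorphic_real_identity (f : R -> R) (M : R) :
  (forall x, meromorphic_real f x) -> (forall x, M < x -> f x = 0) ->
  forall x, analytic_real f x -> f x = 0.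
Proof.
intros mf fM.
assert (Zf : forall x, zero_right f x).
{ intros x.
  destruct (Classical_Prop.classic (zero_right f x)) as [|nx]; [easy|exfalso].
  destruct (completeness (fun y => ~ zero_right f y)) as [m [ub lub]].
  - exists M; intros y ny; apply Rnot_lt_le; intros hy; apply ny.
    exists 1; split; [lra|]; intros; apply fM; lra.
  - now exists x.
  - assert (Zm : zero_right f m).
    { apply meromorphic_real_zero_right; [easy|]; intros y hy.
      destruct (Classical_Prop.classic (zero_right f y)) as [|ny]; [easy|].
      specialize (ub y ny); lra. }
    destruct (meromorphic_real_zero_punctured f m (mf m) Zm) as (r & rp & Hr).
    (* No point beyond [m - r] fails [zero_right]: below [m] by the punctured disc, at [m] by [Zm],
       above [m] because [m] is an upper bound. *)
    enough (m <= m - r) by lra.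
    apply lub; intros y ny; apply Rnot_lt_le; intros hy; apply ny.
    destruct (Rtotal_order y m) as [lt|[->|gt]]; [|easy|specialize (ub y ny); lra].
    exists (m - y); split; [lra|]; intros z hz.
    apply Hr; [lra|]; rewrite Rabs_left; lra. }
intros x (a & r & rp & H).
destruct (Zf x) as (d & dp & Zd).
specialize (H x) as H0.
replace (x - x) with 0 in H0 by ring.
rewrite Rabs_R0 in H0; specialize (H0 rp).
rewrite <- (is_pseries_unique _ _ _ H0).
apply continuity_pt_zero_right with (Rmin r d); [|now apply Rmin_pos|].
- apply PSeries_continuity, (analytic_real_radius _ _ _ _ H); now rewrite Rabs_R0.
- intros y hy; pose proof (Rmin_l r d); pose proof (Rmin_r r d).
  apply is_pseries_unique.
  rewrite <- (Zd (x + y)) by lra.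
  replace y with (x + y - x) at 1 by ring.
  apply H; replace (x + y - x) with y by ring; rewrite Rabs_right; lra.
Qed.

(** * Complex series and restriction to horizontal lines *)

(** The uniform structure of [C] is the product one, so a ball around [l] is a pair of balls around
    its components. *)
Lemma is_series_C (a : nat -> C) (l : C) :
  is_series (V := C_NormedModule) a l <->
  is_series (fun n => Re (a n)) (Re l) /\ is_series (fun n => Im (a n)) (Im l).
Proof.
assert (e : forall n, sum_n (G := C_AbelianGroup) a n =
  (sum_n (fun n => Re (a n)) n, sum_n (fun n => Im (a n)) n)).
{ induction n as [|n IH]; [now rewrite !sum_O; destruct (a 0%nat)|].
  now rewrite !sum_Sn, IH. }
split.
- intros H.
  assert (H' := proj1 (filterlim_locally (U := C_UniformSpace) (F := eventually) _ l) H).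
  split; apply (filterlim_locally (U := R_UniformSpace) (F := eventually)); intros eps;
    generalize (H' eps); apply filter_imp; intros n; rewrite e; now intros [].
- intros [H1 H2].
  assert (H1' := proj1 (filterlim_locally (U := R_UniformSpace) (F := eventually) _ _) H1).
  assert (H2' := proj1 (filterlim_locally (U := R_UniformSpace) (F := eventually) _ _) H2).
  apply (filterlim_locally (U := C_UniformSpace) (F := eventually)); intros eps.
  generalize (filter_and _ _ (H1' eps) (H2' eps)); apply filter_imp.
  intros n [b1 b2]; rewrite e; now split.
Qed.

Lemma CSeries_unique (a : nat -> C) (l : C) :
  is_series (V := C_NormedModule) a l -> CSeries a = l.
Proof.
rewrite is_series_C; intros [H1 H2].
unfold CSeries; rewrite (is_series_unique _ _ H1), (is_series_unique _ _ H2).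
now destruct l.
Qed.

Lemma is_series_even_odd (a : nat -> C) (l1 l2 : C) :
  is_series (V := C_NormedModule) (fun n => a (2 * n)%nat) l1 ->
  is_series (V := C_NormedModule) (fun n => a (2 * n + 1)%nat) l2 ->
  is_series (V := C_NormedModule) a (l1 + l2)%C.
Proof.
assert (R_case : forall (u : nat -> R) (x y : R),
  is_series (fun n => u (2 * n)%nat) x -> is_series (fun n => u (2 * n + 1)%nat) y ->
  is_series u (x + y)).
(* A series is a power series evaluated at 1, so the even-odd splitting of power series applies. The
   variable [t] covers both 1 and [1 ^ 2]. *)
{ assert (one_pow : forall (v : nat -> R) (t z : R), t = 1 ->
    is_series v z <-> is_pseries v t z).
  { intros v t z ->; unfold is_pseries.
    split; apply is_series_ext; intros n; rewrite pow_n_pow, pow1;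
      unfold scal; simpl; unfold mult; simpl; ring. }
  intros u x y H1 H2.
  apply (one_pow _ 1); [easy|].
  replace (x + y) with (x + 1 * y) by ring.
  apply is_pseries_odd_even; apply one_pow; auto; ring. }
rewrite !is_series_C; intros [] []; split; simpl; auto.
Qed.

(** * Passing closure properties to real and imaginary parts *)

Definition componentwise (P : (R -> R) -> Prop) (f : R -> C) : Prop :=
  P (fun t => Re (f t)) /\ P (fun t => Im (f t)).

(* Makes the closure properties below apply to poles and to power series alike. *)
Definition arithmetic (P : (R -> R) -> Prop) : Prop :=
  (forall f g, (forall t, f t = g t) -> P f -> P g) /\
  (forall c, P (fun _ => c)) /\
  (forall f g, P f -> P g -> P (fun t => f t + g t)) /\
  (forall f g, P f -> P g -> P (fun t => f t * g t)).

Lemma arithmetic_analytic_real (x0 : R) : arithmetic (fun f => analytic_real f x0).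
Proof.
repeat split; eauto using analytic_real_ext, analytic_real_const,
  analytic_real_plus, analytic_real_mult.
Qed.

Lemma arithmetic_meromorphic_real (x0 : R) : arithmetic (fun f => meromorphic_real f x0).
Proof.
repeat split; eauto using meromorphic_real_ext, analytic_real_meromorphic,
  analytic_real_const, meromorphic_real_plus, meromorphic_real_mult.
Qed.

Lemma componentwise_const (P : (R -> R) -> Prop) (c : C) :
  arithmetic P -> componentwise P (fun _ => c).
Proof. intros aP; now destruct aP as (_ & H & _); split. Qed.

Lemma componentwise_plus (P : (R -> R) -> Prop) (f g : R -> C) :
  arithmetic P ->
  componentwise P f -> componentwise P g -> componentwise P (fun t => f t + g t)%C.
Proof. intros (_ & _ & H & _) [] []; split; simpl; auto. Qed.

Lemma componentwise_mult (P : (R -> R) -> Prop) (f g : R -> C) :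
  arithmetic P ->
  componentwise P f -> componentwise P g -> componentwise P (fun t => f t * g t)%C.
Proof.
intros (e & c & p & m) [] []; split; simpl; auto.
(* [arithmetic] offers only sums and products, hence the subtraction as a product with [-1]. *)
apply e with (fun t => Re (f t) * Re (g t) + -1 * (Im (f t) * Im (g t))).
  intros t; unfold Re, Im; ring.
auto.
Qed.

Lemma componentwise_minus (P : (R -> R) -> Prop) (f g : R -> C) :
  arithmetic P ->
  componentwise P f -> componentwise P g -> componentwise P (fun t => f t - g t)%C.
Proof.
intros aP Hf Hg.
destruct (componentwise_plus P f _ aP Hf
  (componentwise_mult P _ _ aP (componentwise_const P (-1) aP) Hg)) as [H1 H2].
destruct aP as (e & _); split; [apply e with (2 := H1)|apply e with (2 := H2)];
  intros t; simpl; unfold Re, Im; ring.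
Qed.

(** On the line, [z - (s + t0)] is the real number [t - t0], so the components have the real
    expansions with coefficients [Re (a n)] and [Im (a n)]. The power [k] clears a pole; [k = 0]
    covers analytic points. *)
Lemma analytic_at_line_pow (k : nat) (f : C -> C) (s : C) (t0 : R) :
  analytic_at (fun z => (z - (s + t0)) ^ k * f z)%C (s + t0)%C ->
  componentwise (fun g => analytic_real (fun t => (t - t0) ^ k * g t) t0)
    (fun t => f (s + t)%C).
Proof.
intros (a & r & rp & H).
assert (H' : forall t, Rabs (t - t0) < r ->
  is_pseries (fun n => Re (a n)) (t - t0) ((t - t0) ^ k * Re (f (s + t)%C)) /\
  is_pseries (fun n => Im (a n)) (t - t0) ((t - t0) ^ k * Im (f (s + t)%C))).
{ intros t ht.
  assert (e : (s + t - (s + t0))%C = RtoC (t - t0)) by (rewrite RtoC_minus; ring).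
  specialize (H (s + t)%C); rewrite e, Cmod_R in H; specialize (H ht).
  apply is_series_C in H; destruct H as [H1 H2].
  assert (pw : forall n, pow_n (K := C_AbsRing) (RtoC (t - t0)) n = RtoC ((t - t0) ^ n)).
  { induction n as [|n IH]; [easy|].
    change (RtoC (t - t0) * pow_n (K := C_AbsRing) (RtoC (t - t0)) n =
      RtoC ((t - t0) * (t - t0) ^ n))%C.
    now rewrite IH, RtoC_mult. }
  rewrite <- RtoC_pow in H1, H2.
  split.
  - replace ((t - t0) ^ k * Re (f (s + t)%C))
      with (Re ((t - t0)%R ^ k * f (s + t))%C)
      by (rewrite <- RtoC_pow; simpl; unfold Re, Im; ring).
    rewrite <- RtoC_pow.
    apply is_series_ext with (2 := H1); intros n; rewrite pw.
    change (Re (RtoC ((t - t0) ^ n) * a n)%C =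
      pow_n (K := R_AbsRing) (t - t0) n * Re (a n)).
    rewrite (pow_n_pow (t - t0) n : pow_n (K := R_AbsRing) _ _ = _); simpl; unfold Re, Im; ring.
  - replace ((t - t0) ^ k * Im (f (s + t)%C))
      with (Im ((t - t0)%R ^ k * f (s + t))%C)
      by (rewrite <- RtoC_pow; simpl; unfold Re, Im; ring).
    rewrite <- RtoC_pow.
    apply is_series_ext with (2 := H2); intros n; rewrite pw.
    change (Im (RtoC ((t - t0) ^ n) * a n)%C =
      pow_n (K := R_AbsRing) (t - t0) n * Im (a n)).
    rewrite (pow_n_pow (t - t0) n : pow_n (K := R_AbsRing) _ _ = _); simpl; unfold Re, Im; ring. }
split; [exists (fun n => Re (a n)), r|exists (fun n => Im (a n)), r];
  (split; [easy|intros t ht; now apply H']).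
Qed.

Lemma analytic_at_line (f : C -> C) (s : C) :
  analytic_at f s -> componentwise (fun g => analytic_real g 0) (fun t => f (s + t)%C).
Proof.
intros (a & r & rp & H).
destruct (analytic_at_line_pow 0 f s 0) as [H1 H2].
- replace (s + 0)%C with s by ring.
  exists a, r; split; [easy|]; intros z hz.
  simpl; rewrite Cmult_1_l; now apply H.
- split; [apply analytic_real_ext with (2 := H1)|apply analytic_real_ext with (2 := H2)];
    intros t; simpl; ring.
Qed.

Lemma meromorphic_at_line (f : C -> C) (s : C) (t : R) :
  (forall z, meromorphic_at f z) ->
  componentwise (fun g => meromorphic_real g t) (fun u => f (s + u)%C).
Proof.
intros H; destruct (H (s + t)%C) as [k Hk].
destruct (analytic_at_line_pow k f s t Hk); split; now exists k.
Qed.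

(** This exhibits the power along the line as a real exponential times a constant, hence analytic in
    [t]. *)
Lemma Rcpow_line (x : R) (s : C) (t : R) :
  Rcpow x (s + t) = (exp (ln x * t) * Rcpow x s)%C.
Proof.
unfold Rcpow, Cexp; simpl.
replace ((fst s + t) * ln x - (snd s + 0) * 0) with
  (ln x * t + (fst s * ln x - snd s * 0)) by ring.
replace ((fst s + t) * 0 + (snd s + 0) * ln x) with (fst s * 0 + snd s * ln x) by ring.
rewrite exp_plus.
apply injective_projections; simpl; ring.
Qed.

Lemma Rcpow_line_analytic (x : R) (s : C) (t0 : R) :
  componentwise (fun g => analytic_real g t0) (fun t => Rcpow x (s + t)).
Proof.
assert (H : componentwise (fun g => analytic_real g t0)
  (fun t => exp (ln x * t) * Rcpow x s)%C).
{ apply componentwise_mult; [apply arithmetic_analytic_real| |].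
  - split; [apply analytic_real_exp|apply (analytic_real_const 0)].
  - apply componentwise_const, arithmetic_analytic_real. }
destruct H as [H1 H2].
split; [apply analytic_real_ext with (2 := H1)|apply analytic_real_ext with (2 := H2)];
  intros t; now rewrite Rcpow_line.
Qed.

Lemma Rcpow_line_meromorphic (x : R) (s : C) (t0 : R) :
  componentwise (fun g => meromorphic_real g t0) (fun t => Rcpow x (s + t)).
Proof.
destruct (Rcpow_line_analytic x s t0); split; now apply analytic_real_meromorphic.
Qed.

Lemma meromorphic_identity (f : R -> C) (M : R) :
  (forall t, componentwise (fun g => meromorphic_real g t) f) ->
  (forall t, M < t -> f t = RtoC 0) ->
  forall t, componentwise (fun g => analytic_real g t) f -> f t = RtoC 0.
Proof.
intros H Z t [A1 A2].
apply injective_projections; simpl.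
- apply (meromorphic_real_identity (fun t => Re (f t)) M); [|intros u hu|easy].
  + intros u; apply H.
  + now rewrite Z.
- apply (meromorphic_real_identity (fun t => Im (f t)) M); [|intros u hu|easy].
  + intros u; apply H.
  + now rewrite Z.
Qed.

(** * Harmonic numbers and convergence *)

(** This is [1 + u <= exp u] at [u = ln x - ln (x + 1)]. *)
Lemma ln_succ_minus_ln (x : R) : 0 < x -> / (x + 1) <= ln (x + 1) - ln x.
Proof.
intros xp.
pose proof (exp_ineq1_le (ln x - ln (x + 1))) as H.
unfold Rminus in H; rewrite exp_plus, exp_Ropp, !exp_ln in H by lra.
replace (x * / (x + 1)) with (1 - / (x + 1)) in H by (field; lra).
lra.
Qed.

(** A discrete derivative of [x ^ e], again from [1 + u <= exp u]; it drives the induction bounding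
    the harmonic numbers. *)
Lemma Rpower_increment (x e : R) :
  0 < x -> 0 < e -> Rpower x e * (e / (x + 1)) <= Rpower (x + 1) e - Rpower x e.
Proof.
intros xp ep.
pose proof (ln_succ_minus_ln x xp) as L.
pose proof (exp_ineq1_le (e * (ln (x + 1) - ln x))) as H.
replace (Rpower (x + 1) e) with (Rpower x e * exp (e * (ln (x + 1) - ln x)))
  by (unfold Rpower; rewrite <- exp_plus; f_equal; ring).
pose proof (exp_pos (e * ln x)) as P; fold (Rpower x e) in P.
assert (e / (x + 1) <= e * (ln (x + 1) - ln x)) by (apply Rmult_le_compat_l; lra).
replace (Rpower x e * exp (e * (ln (x + 1) - ln x)) - Rpower x e)
  with (Rpower x e * (exp (e * (ln (x + 1) - ln x)) - 1)) by ring.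
apply Rmult_le_compat_l; lra.
Qed.

(** The right side telescopes, which bounds the partial sums of the series of exponent [1 + d]. *)
Lemma Rpower_decrement (x d : R) :
  0 < x -> 0 < d ->
  d * Rpower (x + 1) (- (1 + d)) <= Rpower x (- d) - Rpower (x + 1) (- d).
Proof.
intros xp dp.
pose proof (ln_succ_minus_ln x xp) as L.
pose proof (exp_ineq1_le (d * (ln (x + 1) - ln x))) as H.
replace (Rpower x (- d)) with (Rpower (x + 1) (- d) * exp (d * (ln (x + 1) - ln x)))
  by (unfold Rpower; rewrite <- exp_plus; f_equal; ring).
replace (Rpower (x + 1) (- (1 + d))) with (Rpower (x + 1) (- d) * / (x + 1)).
2: { replace (- (1 + d)) with (- d + - (1)) by ring.
     now rewrite Rpower_plus, (Rpower_Ropp _ 1), Rpower_1 by lra. }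
pose proof (exp_pos (- d * ln (x + 1))) as P; fold (Rpower (x + 1) (- d)) in P.
assert (d * / (x + 1) <= d * (ln (x + 1) - ln x)) by (apply Rmult_le_compat_l; lra).
replace (d * (Rpower (x + 1) (- d) * / (x + 1)))
  with (Rpower (x + 1) (- d) * (d * / (x + 1))) by ring.
replace (Rpower (x + 1) (- d) * exp (d * (ln (x + 1) - ln x)) - Rpower (x + 1) (- d))
  with (Rpower (x + 1) (- d) * (exp (d * (ln (x + 1) - ln x)) - 1)) by ring.
apply Rmult_le_compat_l; lra.
Qed.

Lemma Rpower_1_l (y : R) : Rpower 1 y = 1.
Proof. unfold Rpower; now rewrite ln_1, Rmult_0_r, exp_0. Qed.

Lemma ex_series_Rpower (p : R) :
  1 < p -> ex_series (fun n => Rpower (INR (S n)) (- p)).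
Proof.
intros hp; set (d := p - 1); set (u := fun n => Rpower (INR (S n)) (- p)).
apply ex_finite_lim_seq_incr with (1 + / d).
- intros n; rewrite sum_Sn, <- Rplus_0_r at 1.
  apply Rplus_le_compat_l, Rlt_le, exp_pos.
(* The subtracted term makes the bound inductive: its decrease pays for each new summand. *)
- assert (H : forall n, sum_n u n <=
    1 + / d - / d * Rpower (INR (S n)) (- d)).
  { induction n as [|n IH].
    - rewrite sum_O; unfold u; simpl; rewrite !Rpower_1_l; lra.
    - rewrite sum_Sn.
      change (sum_n u n + Rpower (INR (S (S n))) (- p) <=
        1 + / d - / d * Rpower (INR (S (S n))) (- d)).
      rewrite (S_INR (S n)).
      assert (np : 0 < INR (S n)) by apply lt_0_INR, Nat.lt_0_succ.
      assert (dp : 0 < d) by (unfold d; lra).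
      pose proof (Rpower_decrement _ _ np dp) as D.
      replace (1 + d) with p in D by (unfold d; ring).
      apply (Rmult_le_compat_l (/ d)) in D; [|now apply Rlt_le, Rinv_0_lt_compat].
      rewrite <- Rmult_assoc, Rinv_l, Rmult_1_l in D by lra.
      lra. }
  intros n; eapply Rle_trans; [apply H|].
  enough (0 <= / d * Rpower (INR (S n)) (- d)) by lra.
  apply Rmult_le_pos; [|apply Rlt_le, exp_pos].
  apply Rlt_le, Rinv_0_lt_compat; unfold d; lra.
Qed.

(** * Growth and splitting of harmonic numbers *)

Lemma harm_S (n : nat) : harm (S n) = harm n + / INR (S n).
Proof. unfold harm; rewrite sum_n_Sm; [easy|lia]. Qed.

Lemma odd_harm_S (n : nat) : odd_harm (S n) = odd_harm n + / (2 * INR (S n) - 1).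
Proof. unfold odd_harm; rewrite sum_n_Sm; [easy|lia]. Qed.

Lemma harm_0 : harm 0 = 0.
Proof. unfold harm; now rewrite sum_n_m_zero by lia. Qed.

Lemma odd_harm_0 : odd_harm 0 = 0.
Proof. unfold odd_harm; now rewrite sum_n_m_zero by lia. Qed.

Lemma harm_ge_0 (n : nat) : 0 <= harm n.
Proof.
induction n as [|n IH]; [rewrite harm_0; lra|].
rewrite harm_S.
enough (0 < / INR (S n)) by lra.
apply Rinv_0_lt_compat, lt_0_INR; lia.
Qed.

Lemma harm_le (m n : nat) : (m <= n)%nat -> harm m <= harm n.
Proof.
induction 1 as [|n _ IH]; [lra|].
rewrite harm_S.
enough (0 < / INR (S n)) by lra.
apply Rinv_0_lt_compat, lt_0_INR; lia.
Qed.

(** An arbitrarily small power stands in for logarithmic growth. With this constant each step raises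
    the bound by at least [(e + 1) * x ^ e / (x + 1)], which exceeds the new term [1 / (x + 1)]. *)
Lemma harm_le_Rpower (e : R) (n : nat) :
  0 < e -> harm (S n) <= (1 + / e) * Rpower (INR (S n)) e.
Proof.
intros ep; assert (iep := Rinv_0_lt_compat _ ep).
induction n as [|n IH].
- rewrite harm_S, harm_0; simpl; rewrite Rpower_1_l; lra.
- rewrite harm_S, (S_INR (S n)).
  assert (np : 1 <= INR (S n)) by (rewrite S_INR; pose proof (pos_INR n); lra).
  set (x := INR (S n)) in *.
  pose proof (Rpower_increment x e ltac:(lra) ep) as D.
  assert (1 <= Rpower x e).
  { rewrite <- (Rpower_O x) by lra; apply Rle_Rpower; lra. }
  assert (ip : 0 < / (x + 1)) by (apply Rinv_0_lt_compat; lra).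
  assert (/ (x + 1) <= (1 + / e) * (Rpower x e * (e / (x + 1)))).
  { replace ((1 + / e) * (Rpower x e * (e / (x + 1))))
      with ((e + 1) * Rpower x e * / (x + 1)) by (field; lra).
    rewrite <- (Rmult_1_l (/ (x + 1))) at 1.
    apply Rmult_le_compat_r; [lra|].
    rewrite <- (Rmult_1_l 1); apply Rmult_le_compat; lra. }
  apply (Rmult_le_compat_l (1 + / e)) in D; lra.
Qed.

Lemma harm_double (n : nat) : harm (2 * n) = odd_harm n + / 2 * harm n.
Proof.
induction n as [|n IH]; [simpl; rewrite harm_0, odd_harm_0; lra|].
replace (2 * S n)%nat with (S (S (2 * n))) by lia.
rewrite !harm_S, odd_harm_S, IH, !S_INR, mult_INR; simpl (INR 2).
pose proof (pos_INR n); field; lra.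
Qed.

Lemma harm_double_succ (n : nat) : harm (2 * n + 1) = odd_harm (S n) + / 2 * harm n.
Proof.
replace (2 * n + 1)%nat with (S (2 * n)) by lia.
rewrite harm_S, harm_double, odd_harm_S, !S_INR, mult_INR; simpl (INR 2).
pose proof (pos_INR n); field; lra.
Qed.

(** [1 / (j + 1 / 2)] is [2 / (2 * (j + 1) - 1)]; as [j] starts at 0, the index on the right is
    [S n]. *)
Lemma harm_shift_half (n : nat) : harm_shift (1 / 2) n = 2 * odd_harm (S n).
Proof.
unfold harm_shift; induction n as [|n IH].
- rewrite sum_O, odd_harm_S, odd_harm_0; simpl; field.
- rewrite sum_Sn, IH, (odd_harm_S (S n)), !S_INR.
  unfold plus; simpl.
  pose proof (pos_INR n); field; lra.
Qed.

(** * Complex powers and absolute convergence *)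

Lemma Cmod_Rcpow (x : R) (s : C) : Cmod (Rcpow x s) = Rpower x (Re s).
Proof.
unfold Rcpow, Cexp, Cmod, Rpower; simpl.
replace (fst s * ln x - snd s * 0) with (Re s * ln x) by (unfold Re; ring).
set (E := exp (Re s * ln x)); set (y := fst s * 0 + snd s * ln x).
rewrite !Rmult_1_r.
replace (E * cos y * (E * cos y) + E * sin y * (E * sin y)) with (Rsqr E).
- apply sqrt_Rsqr, Rlt_le, exp_pos.
- transitivity (Rsqr E * (Rsqr (sin y) + Rsqr (cos y))).
  + rewrite sin2_cos2; ring.
  + unfold Rsqr; ring.
Qed.

Lemma Rcpow_neq_0 (x : R) (s : C) : Rcpow x s <> RtoC 0.
Proof. apply Cmod_gt_0; rewrite Cmod_Rcpow; apply exp_pos. Qed.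

Lemma Rcpow_mult (x y : R) (s : C) :
  0 < x -> 0 < y -> Rcpow (x * y) s = (Rcpow x s * Rcpow y s)%C.
Proof.
intros xp yp.
unfold Rcpow, Cexp; simpl; rewrite ln_mult by easy.
replace (fst s * (ln x + ln y) - snd s * 0) with
  ((fst s * ln x - snd s * 0) + (fst s * ln y - snd s * 0)) by ring.
replace (fst s * 0 + snd s * (ln x + ln y)) with
  ((fst s * 0 + snd s * ln x) + (fst s * 0 + snd s * ln y)) by ring.
set (a := fst s * 0 + snd s * ln x); set (b := fst s * 0 + snd s * ln y).
rewrite exp_plus, cos_plus, sin_plus.
apply injective_projections; simpl; ring.
Qed.

Lemma Rcpow_minus_1 (x : R) (s : C) : 0 < x -> Rcpow x (s - 1) = (Rcpow x s / x)%C.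
Proof.
intros xp.
replace (s - 1)%C with (s + (-1)%R)%C by ring.
rewrite Rcpow_line.
replace (ln x * -1) with (- ln x) by ring.
rewrite exp_Ropp, exp_ln, RtoC_inv by lra.
unfold Cdiv; ring.
Qed.

(** One comparison serves three series: the odd and the even terms of [zeta_H], and the terms
    [H_n / (n + 1 / 2) ^ s]. The bounds on [k] and [x] are just wide enough for all three. *)
Lemma ex_series_harm (k : nat -> nat) (x : nat -> R) (s : C) :
  1 < Re s -> (forall n, (k n <= 2 * S n)%nat) -> (forall n, INR (S n) / 2 <= x n) ->
  ex_series (V := C_NormedModule) (fun n => harm (k n) / Rcpow (x n) s)%C.
Proof.
intros hs hk hx.
(* Harmonic growth consumes [e], half the excess of [Re s] over 1, and leaves the summable exponent
   [1 + e]. *)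
set (e := (Re s - 1) / 2).
assert (ep : 0 < e) by (unfold e; lra).
assert (iep := Rinv_0_lt_compat _ ep).
(* The three factors come from the harmonic bound, from [k n <= 2 * S n] and from
   [x n >= S n / 2]. *)
set (K := (1 + / e) * Rpower 2 e * Rpower 2 (Re s)).
apply (ex_series_le (V := C_CompleteNormedModule) _
  (fun n => K * Rpower (INR (S n)) (- (1 + e)))).
2: { apply (ex_series_scal_l (V := R_NormedModule)), ex_series_Rpower; lra. }
intros n; change (Cmod (harm (k n) / Rcpow (x n) s) <=
  K * Rpower (INR (S n)) (- (1 + e))).
rewrite Cmod_div by apply Rcpow_neq_0.
rewrite Cmod_R, Rabs_right, Cmod_Rcpow by apply Rle_ge, harm_ge_0.
assert (np : 0 < INR (S n)) by (apply lt_0_INR; lia).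
assert (H1 : harm (k n) <= (1 + / e) * (Rpower 2 e * Rpower (INR (S n)) e)).
{ eapply Rle_trans; [apply harm_le, hk|].
  replace (2 * S n)%nat with (S (2 * n + 1)) by lia.
  rewrite Rpower_mult_distr by lra.
  replace (2 * INR (S n)) with (INR (S (2 * n + 1))).
  - now apply harm_le_Rpower.
  - rewrite !S_INR, plus_INR, mult_INR; simpl; ring. }
assert (H2 : / Rpower (x n) (Re s) <= Rpower 2 (Re s) * Rpower (INR (S n)) (- Re s)).
{ replace (Rpower 2 (Re s) * Rpower (INR (S n)) (- Re s))
    with (/ Rpower (INR (S n) / 2) (Re s)).
  - apply Rinv_le_contravar; [apply exp_pos|].
    apply Rle_Rpower_l; [lra|split; [lra|apply hx]].
  - unfold Rdiv; rewrite <- Rpower_mult_distr, Rpower_Ropp by lra.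
    rewrite <- (Rpower_1 2) at 1 by lra.
    rewrite <- Rpower_Ropp, Rpower_mult.
    replace (- (1) * Re s) with (- Re s) by ring.
    rewrite Rpower_Ropp.
    assert (0 < Rpower 2 (Re s)) by apply exp_pos.
    assert (0 < Rpower (INR (S n)) (Re s)) by apply exp_pos.
    field; lra. }
replace (- (1 + e)) with (e + - Re s) by (unfold e; field).
rewrite Rpower_plus.
replace (K * (Rpower (INR (S n)) e * Rpower (INR (S n)) (- Re s)))
  with ((1 + / e) * (Rpower 2 e * Rpower (INR (S n)) e) *
    (Rpower 2 (Re s) * Rpower (INR (S n)) (- Re s))) by (unfold K; ring).
apply Rmult_le_compat; [apply harm_ge_0| |easy|easy].
apply Rlt_le, Rinv_0_lt_compat, exp_pos.
Qed.

(** * The relations *)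

Lemma RtoC_pow_m1_even (n : nat) : (RtoC (-1) ^ (2 * n))%C = RtoC 1.
Proof. now rewrite <- RtoC_pow, pow_1_even. Qed.

Lemma RtoC_pow_m1_odd (n : nat) : (RtoC (-1) ^ (2 * n + 1))%C = RtoC (-1).
Proof. now rewrite <- RtoC_pow, Nat.add_1_r, pow_1_odd. Qed.

Lemma is_series_C_ext (a b : nat -> C) (l : C) : (forall n, a n = b n) ->
  is_series (V := C_NormedModule) a l -> is_series (V := C_NormedModule) b l.
Proof. apply (is_series_ext (V := C_NormedModule)). Qed.

Lemma is_series_C_lincomb (a b c : nat -> C) (x y lb lc : C) :
  (forall n, a n = x * b n + y * c n)%C ->
  is_series (V := C_NormedModule) b lb -> is_series (V := C_NormedModule) c lc ->
  is_series (V := C_NormedModule) a (x * lb + y * lc)%C.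
Proof.
intros e hb hc.
apply (is_series_ext (fun n => x * b n + y * c n)%C); [now intros n; rewrite e|].
apply (is_series_plus (V := C_NormedModule));
  now apply (is_series_scal (V := C_NormedModule)).
Qed.

(** All five functions are linear combinations of three convergent sums [e], [o] and [B], which
    reduces both relations to algebra. *)
Lemma harm_series_relations (s : C) : 1 < Re s ->
  S_half s = (Rcpow 2 s * (eta_H s + zeta_H s) - zeta_H_half s)%C /\
  zeta_O s = (1 / 2 * (Rcpow 2 s - 1) * zeta_H s - Rcpow 2 (s - 1) * eta_H s)%C.
Proof.
intros hs.
(* Position [n] holds the term of [S n], so [e], the sum over even positions, collects the odd
   integers, and [o] the even ones. *)
set (c := fun n => (harm (S n) / Rcpow (INR (S n)) s)%C).
(* Starting at index 0 aligns [h] with [zeta_H_half]; since [harm 0 = 0], its sum is still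
   [S_half s]. *)
set (h := fun n => (harm n / Rcpow (INR n + 1 / 2) s)%C).
assert (ev : ex_series (V := C_NormedModule) (fun n => c (2 * n)%nat)).
{ apply ex_series_harm; [easy|lia|].
  intros n; rewrite !S_INR, mult_INR; simpl (INR 2); pose proof (pos_INR n); lra. }
assert (od : ex_series (V := C_NormedModule) (fun n => c (2 * n + 1)%nat)).
{ apply ex_series_harm; [easy|lia|].
  intros n; rewrite !S_INR, plus_INR, mult_INR; simpl (INR 2); simpl (INR 1).
  pose proof (pos_INR n); lra. }
assert (hh : ex_series (V := C_NormedModule) h).
{ apply ex_series_harm; [easy|lia|].
  intros n; rewrite !S_INR; pose proof (pos_INR n); lra. }
destruct ev as [e He]; destruct od as [o Ho]; destruct hh as [B HB].
change C in (type of e), (type of o), (type of B).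
assert (Z : is_series (V := C_NormedModule) c (e + o)%C).
{ now apply is_series_even_odd. }
assert (eqZ : zeta_H s = (e + o)%C) by now apply CSeries_unique.
assert (eqE : eta_H s = (e + (-1) * o)%C).
{ apply CSeries_unique, is_series_even_odd.
  - apply (is_series_C_ext (fun n => c (2 * n)%nat)); [|easy].
    intros n; rewrite RtoC_pow_m1_even; unfold c, Cdiv; ring.
  - apply (is_series_C_ext (fun n => -1 * c (2 * n + 1)%nat)%C).
    + intros n; rewrite RtoC_pow_m1_odd; unfold c, Cdiv; ring.
    + now apply (is_series_scal (V := C_NormedModule) (RtoC (-1))). }
assert (eqS : S_half s = B).
{ apply CSeries_unique, (is_series_incr_1 (V := C_NormedModule) h).
  change (is_series (V := C_NormedModule) h (B + h 0%nat)%C).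
  replace (B + h 0%nat)%C with B; [easy|].
  unfold h; rewrite harm_0; unfold Cdiv; ring. }
(* From [H_n(1/2) = 2 H_(2n+1) - H_n] and [(2n+1)^s = 2^s (n+1/2)^s]. *)
assert (eqH : zeta_H_half s = (2 * Rcpow 2 s * e + (-1) * B)%C).
{ apply CSeries_unique.
  apply is_series_C_lincomb with (2 := He) (3 := HB); intros n.
  unfold c, h; rewrite harm_shift_half.
  replace (S (2 * n)) with (2 * n + 1)%nat by lia.
  pose proof (pos_INR n).
  rewrite harm_double_succ.
  replace (INR (2 * n + 1)) with (2 * (INR n + 1 / 2))
    by (rewrite plus_INR, mult_INR; simpl; field).
  rewrite Rcpow_mult, !RtoC_plus, !RtoC_mult, RtoC_inv by lra.
  field; split; apply Rcpow_neq_0. }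
(* From [O_n = H_(2n) - H_n / 2] and [(2n)^s = 2^s n^s]. *)
assert (eqO : zeta_O s = (Rcpow 2 s * o + (- / 2) * (e + o))%C).
{ apply CSeries_unique.
  apply is_series_C_lincomb with (2 := Ho) (3 := Z); intros n.
  unfold c.
  replace (S (2 * n + 1)) with (2 * S n)%nat by lia.
  pose proof (pos_INR n).
  rewrite harm_double.
  replace (INR (2 * S n)) with (2 * INR (S n)) by (rewrite mult_INR; easy).
  rewrite Rcpow_mult, !RtoC_plus, !RtoC_mult, RtoC_inv
    by first [lra|apply lt_0_INR; lia].
  field; repeat split; try apply Rcpow_neq_0. }
split.
- rewrite eqS, eqE, eqZ, eqH; ring.
- rewrite eqO, eqE, eqZ, Rcpow_minus_1 by lra; field.
Qed.

(** The continued identities are stated where all continuations involved are analytic, since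
    [meromorphic_at] leaves values at poles arbitrary. *)
Theorem theorem3 :
  (forall s : C, 1 < Re s ->
     S_half s = (Rcpow 2 s * (eta_H s + zeta_H s) - zeta_H_half s)%C /\
     zeta_O s = (1 / 2 * (Rcpow 2 s - 1) * zeta_H s - Rcpow 2 (s - 1) * eta_H s)%C) /\
  (forall SH E Z Zhalf : C -> C,
     meromorphic_continuation S_half SH ->
     meromorphic_continuation eta_H E ->
     meromorphic_continuation zeta_H Z ->
     meromorphic_continuation zeta_H_half Zhalf ->
     forall s : C,
       analytic_at SH s -> analytic_at E s -> analytic_at Z s -> analytic_at Zhalf s ->
       SH s = (Rcpow 2 s * (E s + Z s) - Zhalf s)%C) /\
  (forall ZO E Z : C -> C,
     meromorphic_continuation zeta_O ZO ->
     meromorphic_continuation eta_H E ->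
     meromorphic_continuation zeta_H Z ->
     forall s : C,
       analytic_at ZO s -> analytic_at E s -> analytic_at Z s ->
       ZO s = (1 / 2 * (Rcpow 2 s - 1) * Z s - Rcpow 2 (s - 1) * E s)%C).
Proof.
assert (line : forall s t, 1 - Re s < t -> 1 < Re (s + RtoC t)%C)
  by (intros s t; simpl; unfold Re; lra).
(* An abstract [P] lets one closure argument serve twice: for meromorphy at every [t] and for
   analyticity at 0. *)
assert (half : forall P, arithmetic P -> forall p a b c d,
  componentwise P p -> componentwise P a -> componentwise P b -> componentwise P c ->
  componentwise P d ->
  componentwise P (fun t => a t - (p t * (b t + c t) - d t))%C).
{ intros; apply componentwise_minus; [easy..|].
  apply componentwise_minus; [easy| |easy].
  apply componentwise_mult; [easy..|now apply componentwise_plus]. }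
assert (odd : forall P, arithmetic P -> forall p a b c,
  componentwise P p -> componentwise P a -> componentwise P b -> componentwise P c ->
  componentwise P (fun t => a t - (1 / 2 * (p t - 1) * b t - p t * / 2 * c t))%C).
{ intros; repeat first [ easy | apply componentwise_minus | apply componentwise_const
    | apply componentwise_mult ]. }
split; [exact harm_series_relations|split].
- intros SH E Z Zhalf [mS eS] [mE eE] [mZ eZ] [mH eH] s aS aE aZ aH.
  (* The defect of the relation along the line through [s]; it vanishes for [t > 1 - Re s], where
     the series relations hold. *)
  set (rel := fun t : R => (SH (s + t) -
    (Rcpow 2 (s + t) * (E (s + t) + Z (s + t)) - Zhalf (s + t)))%C).
  enough (H : rel 0 = RtoC 0).
  { unfold rel in H; rewrite Cplus_0_r in H.
    rewrite <- (Cplus_0_r (_ - Zhalf s)%C), <- H; ring. }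
  apply (meromorphic_identity rel (1 - Re s)).
  + intros t; apply (half _ (arithmetic_meromorphic_real t) (fun t => Rcpow 2 (s + t)));
      [apply Rcpow_line_meromorphic|now apply meromorphic_at_line..].
  + intros t ht; specialize (line s t ht); unfold rel.
    destruct (harm_series_relations _ line) as [e _].
    rewrite eS, eE, eZ, eH, e by easy; ring.
  + apply (half _ (arithmetic_analytic_real 0) (fun t => Rcpow 2 (s + t)));
      [apply Rcpow_line_analytic|now apply analytic_at_line..].
- intros ZO E Z [mO eO] [mE eE] [mZ eZ] s aO aE aZ.
  (* Here [2^(s+t-1)] is written as [2^(s+t) / 2], so that a single power function occurs. *)
  set (rel := fun t : R => (ZO (s + t) - (1 / 2 * (Rcpow 2 (s + t) - 1) * Z (s + t) -
    Rcpow 2 (s + t) * / 2 * E (s + t)))%C).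
  rewrite Rcpow_minus_1 by lra.
  enough (H : rel 0 = RtoC 0).
  { unfold rel in H; rewrite Cplus_0_r in H.
    rewrite <- (Cplus_0_r (_ - _)%C), <- H; unfold Cdiv; ring. }
  apply (meromorphic_identity rel (1 - Re s)).
  + intros t; apply (odd _ (arithmetic_meromorphic_real t) (fun t => Rcpow 2 (s + t)));
      [apply Rcpow_line_meromorphic|now apply meromorphic_at_line..].
  + intros t ht; specialize (line s t ht); unfold rel.
    destruct (harm_series_relations _ line) as [_ e].
    rewrite Rcpow_minus_1 in e by lra.
    rewrite eO, eE, eZ, e by easy; unfold Cdiv; ring.
  + apply (odd _ (arithmetic_analytic_real 0) (fun t => Rcpow 2 (s + t)));
      [apply Rcpow_line_analytic|now apply analytic_at_line..].
Qed.
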